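(* Up to homeomorphism, every Stone's space is the ultrafilter space of some Boolean algebra. More specifically, if $X$ is a Stone's space, then $X$ is homeomorphic to $\mathcal{U}(\mathrm{Clop}(X))$.
   Context: A Stone's space is a compact Hausdorff totally disconnected topological space. For a topological space $X$, $\mathrm{Clop}(X)$ is the Boolean algebra of all clopen subsets of $X$ with join $+=\cup$, meet $\cdot=\cap$, complement $\neg A=X\setminus A$. For a Boolean algebra $(B,+,\cdot,\neg)$ with order $x\leqslant y\iff x+y=y$, a filter of $B$ is a nonempty subset $F\subset B$ closed under $\cdot$ and upward closed for $\leqslant$; it is proper if $F\neq B$. An ultrafilter of $B$ is a proper filter $F$ such that for every $x\in B$ exactly one of $x,\neg x$ lies in $F$. The ultrafilter space $\mathcal{U}(B)$ is the set of all ultrafilters of $B$, with the topology having as a basis the sets $U_x=\{F\in\mathcal{U}(B):x\in F\}$, $x\in B$. *)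

(* Defs.v *)
From HB Require Import structures.
From mathcomp Require Import all_boot all_order.
From mathcomp Require Import all_classical topology.

Set Implicit Arguments.
Unset Strict Implicit.
Unset Printing Implicit Defensive.
Import Order.TTheory.
Local Open Scope classical_set_scope.

Definition stone_space (X : topologicalType) : Prop :=
  [/\ compact [set: X], hausdorff_space X & totally_disconnected [set: X]].

Definition homeomorphic (X Y : topologicalType) : Prop :=
  exists (f : X -> Y) (g : Y -> X),
    [/\ cancel f g, cancel g f, continuous f & continuous g].

(* Boolean algebras are complemented distributive lattices with top and
   bottom; \bot = \top is allowed, so that Clop of the empty space is one. *)
Section Ultrafilters.
Context (d : Order.disp_t) (B : ctbDistrLatticeType d).

Definition is_filter (F : set B) : Prop :=
  [/\ F !=set0,
      forall x y, F x -> F y -> F (x `&` y)%O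
    & forall x y, F x -> (x <= y)%O -> F y].

Definition is_ultrafilter (F : set B) : Prop :=
  [/\ is_filter F,
      F <> [set: B]
    & forall x, (F x /\ ~ F (~` x)%O) \/ (~ F x /\ F (~` x)%O)].

Definition ultrafilter_space : Type := set_type is_ultrafilter.

HB.instance Definition _ :=
  Choice.copy ultrafilter_space (set_type is_ultrafilter).

Definition ultra_basic (x : B) : set ultrafilter_space :=
  [set F | (set_val F : set B) x].

Let ultra_basis : set (set ultrafilter_space) := range ultra_basic.

Let ultra_basis_cover : \bigcup_(U in ultra_basis) U = setT.
Proof.
apply/seteqP; split=> // F _.
have [[[x Fx] _ _] _ _] := set_valP F.
by exists (ultra_basic x) => //; exists x.
Qed.

Let ultra_basis_join (U V : set ultrafilter_space) F :
  ultra_basis U -> ultra_basis V -> U F -> V F ->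
  exists W, [/\ ultra_basis W, W F & W `<=` U `&` V].
Proof.
move=> [x _ <-] [y _ <-] Fx Fy; exists (ultra_basic (x `&` y)%O); split.
- by exists (x `&` y)%O.
- by have [[_ FI _] _ _] := set_valP F; exact: FI.
- move=> G Gxy; have [[_ _ GS] _ _] := set_valP G.
  by split; apply: GS Gxy _; [exact: leIl | exact: leIr].
Qed.

HB.instance Definition _ := isBaseTopological.Build ultrafilter_space
  ultra_basis_cover ultra_basis_join.

Lemma open_ultrafilter_spaceP (A : set ultrafilter_space) :
  open A <-> exists D : set B, A = \bigcup_(x in D) ultra_basic x.
Proof.
split=> [[D' D'b <-]|[D ->]].
- exists [set x | D' (ultra_basic x)]; apply/seteqP; split=> F.
    by move=> [U D'U UF]; have [x _ xU] := D'b _ D'U; exists x; rewrite /= xU.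
  by move=> [x Dx xF]; exists (ultra_basic x).
- exists (ultra_basic @` D); first by move=> _ [x _ <-]; exists x.
  by apply/seteqP; split=> F [] => [_ [x Dx <-]|x Dx] xF;
    [exists x | exists (ultra_basic x) => //; exists x].
Qed.

End Ultrafilters.

Section ClopenAlgebra.
Context (X : topologicalType).

Definition Clop : Type := set_type (@clopen X).

HB.instance Definition _ := Choice.copy Clop (set_type (@clopen X)).

Implicit Types A B C : Clop.

Definition clop_set A : set X := set_val A.

Lemma clop_setP A : clopen (clop_set A). Proof. exact: set_valP. Qed.

Lemma clop_set_inj : injective clop_set. Proof. exact: val_inj. Qed.

Definition MkClop (A : set X) (cA : clopen A) : Clop :=
  SigSub (mem_set cA).

Definition clop_join A B : Clop :=
  MkClop (clopenU (clop_setP A) (clop_setP B)).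
Definition clop_meet A B : Clop :=
  MkClop (clopenI (clop_setP A) (clop_setP B)).
(* [set0] fills an argument of [clopenC] that its conclusion does not use. *)
Definition clop_compl A : Clop := MkClop (clopenC set0 (clop_setP A)).
Definition clop_bot : Clop := MkClop clopen0.
Definition clop_top : Clop := MkClop clopenT.
Definition clop_le A B : bool := clop_join A B == B.
Definition clop_lt A B : bool := (B != A) && clop_le A B.

Let le_def A B : clop_le A B = (clop_meet A B == A).
Proof.
apply/eqP/eqP => /(congr1 clop_set) h; apply: clop_set_inj; move: h => /=.
- by move=> /setUidPr/setIidPl.
- by move=> /setIidPl/setUidPr.
Qed.

Let lt_def A B : clop_lt A B = (B != A) && clop_le A B. Proof. by []. Qed.

Let meetC : commutative clop_meet.
Proof. by move=> A B; apply: clop_set_inj; exact: setIC. Qed.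

Let joinC : commutative clop_join.
Proof. by move=> A B; apply: clop_set_inj; exact: setUC. Qed.

Let meetA : associative clop_meet.
Proof. by move=> A B C; apply: clop_set_inj; exact: setIA. Qed.

Let joinA : associative clop_join.
Proof. by move=> A B C; apply: clop_set_inj; exact: setUA. Qed.

Let joinKI B A : clop_meet A (clop_join A B) = A.
Proof. by apply: clop_set_inj; apply/setIidPl; exact: subsetUl. Qed.

Let meetKU B A : clop_join A (clop_meet A B) = A.
Proof. by apply: clop_set_inj; apply/setUidPl; exact: subIsetl. Qed.

Let meetUl : left_distributive clop_meet clop_join.
Proof. by move=> A B C; apply: clop_set_inj; exact: setIUl. Qed.

Let meetxx : idempotent_op clop_meet.
Proof. by move=> A; apply: clop_set_inj; exact: setIid. Qed.

HB.instance Definition _ := Order.isMeetJoinDistrLattice.Build set_display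
  Clop le_def lt_def meetC joinC meetA joinA joinKI meetKU meetUl meetxx.

Let bot_le A : (clop_bot <= A)%O.
Proof. by apply/eqP/clop_set_inj; exact: set0U. Qed.

Let le_top A : (A <= clop_top)%O.
Proof. by apply/eqP/clop_set_inj; exact: setUT. Qed.

HB.instance Definition _ := Order.hasBottom.Build set_display Clop bot_le.
HB.instance Definition _ := Order.hasTop.Build set_display Clop le_top.

Let joinxC A : (A `|` clop_compl A)%O = \top%O.
Proof. by apply: clop_set_inj; exact: setUv. Qed.

Let meetxC A : (A `&` clop_compl A)%O = \bot%O.
Proof. by apply: clop_set_inj; exact: setICr. Qed.

HB.instance Definition _ :=
  Order.TBDistrLattice_hasComplement.Build set_display Clop joinxC meetxC.

Lemma clop_setU A B : clop_set (A `|` B)%O = clop_set A `|` clop_set B.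
Proof. by []. Qed.

Lemma clop_setI A B : clop_set (A `&` B)%O = clop_set A `&` clop_set B.
Proof. by []. Qed.

Lemma clop_setC A : clop_set (~` A)%O = ~` clop_set A.
Proof. by []. Qed.

Lemma clop_leP A B : (A <= B)%O <-> clop_set A `<=` clop_set B.
Proof.
split=> [/eqP/(congr1 clop_set)/setUidPr //|/setUidPr h].
by apply/eqP/clop_set_inj.
Qed.

End ClopenAlgebra.

(* Main.v *)
Require Import Defs.
From mathcomp Require Import all_boot all_order.
From mathcomp Require Import all_classical topology.

(** A point [x] of a space determines the ultrafilter of the clopen sets that
    contain it, and for a Stone space this is a homeomorphism onto the
    ultrafilter space of the clopen algebra.

    - Every ultrafilter comes from a point, because the space is compact: an
      ultrafilter of clopen sets is a base of a proper filter of subsets; a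
      cluster point of that filter lies in all its closed members, and an
      ultrafilter contained in another one is equal to it
      ([ultrafilter_fixed]).
    - Distinct points give distinct ultrafilters, because clopen sets separate
      points ([stone_zero_dimensional]). This is where total disconnectedness
      enters, and it is the only delicate step: in a compact Hausdorff space
      the intersection of the clopen sets around [x] is connected
      ([quasi_component_connected]), so that it is contained in the component
      of [x], which is [[set x]].
    - The map is continuous because the preimage of the basic open set given by
      a clopen set [A] is [A]; its inverse is continuous because, by compactness
      again, the clopen sets are a base of the topology. *)

Set Implicit Arguments.
Unset Strict Implicit.
Unset Printing Implicit Defensive.
Local Open Scope classical_set_scope.

(** * Clopen neighbourhoods in compact Hausdorff spaces *)

Section CompactSpaces.
Context {X : topologicalType}.
Implicit Types (x y : X) (A B U : set X).

(** If [U] were not in [F], then the trace of [F] on the closed set [~` U] would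
    be a proper filter, and a cluster point of it would be outside [U] and in
    every closed member of [F]. *)
Lemma compact_closed_filter_sub (F : set_system X) U :
  compact [set: X] -> Filter F -> open U ->
  \bigcap_(A in [set A | F A /\ closed A]) A `<=` U -> F U.
Proof.
move=> cptX FF oU FU; apply: contrapT => nFU.
pose G := within (~` U) F.
have GF : ProperFilter G.
  split; last exact: within_filter.
  by move=> nU; apply: nFU; apply: (@filterS _ F _ _ _ _ nU) => z /contrapT.
have [x [_]] := cptX G GF filterT.
rewrite clusterE => Gx.
have closed_mem A : closed A -> G A -> A x.
  by move=> /closure_id cA GA; rewrite cA; exact: Gx.
have nUx : (~` U) x.
  by apply: closed_mem (open_closedC oU) _; exact: withinT.
apply: nUx; apply: FU => A [FA cA]; apply: closed_mem => //.
exact: (@cvg_within _ F _ (~` U)).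
Qed.

Definition quasi_component x : set X :=
  \bigcap_(A in [set A | A x /\ clopen A]) A.

(** By compactness, [U `|` V] already contains a clopen set [K] around [x]. The
    traces of [K] on the disjoint open sets [U] and [V] are clopen, and the one
    containing [x] contains the quasi-component. *)
Lemma quasi_component_split x U V :
  compact [set: X] -> open U -> open V -> U `&` V = set0 ->
  quasi_component x `<=` U `|` V ->
  quasi_component x `<=` U \/ quasi_component x `<=` V.
Proof.
move=> cptX oU oV UV0 QUV.
pose F := filter_from [set A : set X | A x /\ clopen A] id.
have FF : Filter F.
  apply: filter_from_filter; first by exists setT; split => //; exact: clopenT.
  move=> A B [Ax cA] [Bx cB]; exists (A `&` B) => //.
  by split=> //; exact: clopenI.
have [K [Kx [oK cK]] KUV] : F (U `|` V).
  apply: compact_closed_filter_sub => //; first exact: openU.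
  move=> y Fy; apply: QUV => A [Ax [oA cA]]; apply: Fy; split=> //.
  by exists A.
have trace_sub (S T : set X) : open S -> open T -> S `&` T = set0 ->
    K `<=` S `|` T -> S x -> quasi_component x `<=` S.
  move=> oS oT ST0 KST Sx y Qy.
  suff : (K `&` S) y by case.
  apply: Qy; split=> //; split; first exact: openI.
  have -> : K `&` S = K `&` ~` T.
    apply/seteqP; split=> z [Kz]; first move=> Sz.
      by split=> // Tz; have : (S `&` T) z by []; rewrite ST0.
    by move=> nTz; split=> //; case: (KST _ Kz).
  by apply: closedI => //; exact: open_closedC.
case: (KUV _ Kx) => [Ux|Vx]; first by left; apply: (trace_sub U V).
by right; apply: (trace_sub V U); rewrite // 1?setIC // setUC.
Qed.

Lemma quasi_component_closed x : closed (quasi_component x).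
Proof. by apply: closed_bigI => A [_ []]. Qed.

(** The two pieces of a separation of the quasi-component would be disjoint
    closed sets of the space, so by normality they would have disjoint open
    neighbourhoods, one of which contains the whole quasi-component. *)
Lemma quasi_component_connected x :
  compact [set: X] -> hausdorff_space X -> connected (quasi_component x).
Proof.
move=> cptX hX B [b Bb] [C oC BC] [D cD BD].
set Q := quasi_component x in BC BD *.
have cQ : closed Q := @quasi_component_closed x.
have cB : closed B by rewrite BD; exact: closedI.
have oQB : open (~` (Q `&` ~` C)).
  by apply: closed_openC; apply: closedI => //; exact: open_closedC.
have [N BN NQB] : filter_from (set_nbhs B) closure (~` (Q `&` ~` C)).
  apply: compact_normal => // z Bz; apply: open_nbhs_nbhs; split=> //.
  by move: Bz; rewrite BC => -[_ Cz] [_].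
have BNo : B `<=` N° by move=> z Bz; exact: BN.
(* [N] is a neighbourhood of [B] whose closure misses [Q `\` B]: its interior
   and the complement of its closure are the two open sets. *)
have [] := @quasi_component_split x N° (~` closure N) cptX.
- exact: open_interior.
- exact/closed_openC/closed_closure.
- rewrite -subset0 => z [/interior_subset Nz nNz]; apply: nNz.
  exact: subset_closure.
- move=> z Qz; case: (pselect (C z)) => Cz.
    by left; apply: BNo; rewrite BC.
  by right=> /NQB; apply.
- move=> QN; rewrite BC; apply/setIidPl => z Qz; apply: contrapT => nCz.
  by apply: (NQB z) => //; exact: subset_closure (interior_subset (QN z Qz)).
- have Qb : Q b by move: Bb; rewrite BC => -[].
  move=> /(_ _ Qb) nNb; exfalso; apply: nNb.
  exact: subset_closure (interior_subset (BNo b Bb)).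
Qed.

Lemma stone_zero_dimensional : stone_space X -> zero_dimensional X.
Proof.
move=> [cptX hX tdX] x y /eqP xy; apply: contrapT => nsep.
have Qy : quasi_component x y.
  move=> A [Ax cA]; apply: contrapT => nAy.
  by apply: nsep; exists A.
have : connected_component setT x y.
  exists (quasi_component x) => //; split=> //; first by move=> A [].
  exact: quasi_component_connected.
by rewrite tdX // => yx; apply: xy.
Qed.

End CompactSpaces.

(** * Points and ultrafilters of clopen sets *)

(** If [x] were in [G] and not in [F], then its complement would be in [F],
    hence in [G] together with [x]. *)
Lemma ultrafilter_max d (B : ctbDistrLatticeType d) (F G : set B) :
  is_ultrafilter F -> is_ultrafilter G -> F `<=` G -> F = G.
Proof.
move=> [_ _ uF] [_ _ uG] FG; apply/seteqP; split=> // x Gx.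
case: (uF x) => [[]//|[_ /FG Gxc]].
by case: (uG x) => [[_ /(_ Gxc)]|[/(_ Gx)]].
Qed.

Section PointUltrafilter.
Context {X : topologicalType}.
Implicit Types (x : X) (A B : Clop X).

Lemma point_ultrafilterP x :
  is_ultrafilter [set A : Clop X | clop_set A x].
Proof.
split; first split.
- by exists \top%O.
- by move=> A B Ax Bx; split.
- by move=> A B Ax /clop_leP; apply.
- by move=> /seteqP[_ /(_ \bot%O I)].
- move=> A; rewrite /= clop_setC.
  by case: (pselect (clop_set A x)) => Ax; [left|right]; split.
Qed.

Definition point_ultrafilter x : ultrafilter_space (Clop X) :=
  SigSub (mem_set (point_ultrafilterP x)).

Lemma continuous_point_ultrafilter : continuous point_ultrafilter.
Proof.
apply/continuousP => _ /open_ultrafilter_spaceP[D ->].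
rewrite preimage_bigcup; apply: bigcup_open => A _.
by have [] := clop_setP A.
Qed.

(** A member of an ultrafilter of clopen sets is nonempty, since otherwise
    every clopen set would be above it and the ultrafilter would be improper. *)
Lemma ultrafilter_clop_nonempty (F : set (Clop X)) A :
  is_ultrafilter F -> F A -> clop_set A !=set0.
Proof.
move=> [[_ _ FS] FT _] FA; apply/set0P/eqP => A0; apply: FT.
apply/seteqP; split=> // B _; apply: FS FA _.
by apply/clop_leP; rewrite A0.
Qed.

Lemma ultrafilter_fixed (F : ultrafilter_space (Clop X)) :
  compact [set: X] -> exists x, point_ultrafilter x = F.
Proof.
move=> cptX; have uF := set_valP F; have [[F0 FI FS] _ _] := uF.
pose G := filter_from (set_val F) (@clop_set X).
have GF : ProperFilter G.
  apply: filter_from_proper => [|A FA]; last exact: ultrafilter_clop_nonempty FA.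
  apply: filter_from_filter => // A B FA FB.
  by exists (A `&` B)%O => //; exact: FI.
have [x [_]] := cptX G GF filterT.
rewrite clusterE => Gx; exists x; apply: val_inj; apply/esym.
apply: ultrafilter_max => //; first exact: point_ultrafilterP.
move=> A FA; have [_ /closure_id cA] := clop_setP A.
by rewrite /= cA; apply: Gx; exists A.
Qed.

End PointUltrafilter.

Lemma stone_homeomorphic_ultrafilter_space (X : topologicalType) :
  stone_space X -> homeomorphic X (ultrafilter_space (Clop X)).
Proof.
move=> sX; have zX := stone_zero_dimensional sX; have [cptX hX _] := sX.
have [g gK] := choice (fun F => @ultrafilter_fixed X F cptX).
exists point_ultrafilter, g; split=> //.
- move=> x; apply/eqP/negPn/negP => /zX[U [cU Ugx nUx]].
  have := congr1 (fun F => set_val F (MkClop cU)) (gK (point_ultrafilter x)).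
  by move=> /= e; apply: nUx; rewrite -[U x]e.
- exact: continuous_point_ultrafilter.
- move=> F U /(zero_dimensional_cvg hX zX cptX)[A [AgF cA] AU].
  (* As [G] is the ultrafilter of the point [g G], containing [A] amounts to
     [g G] being in [A]. *)
  have gA : ultra_basic (MkClop cA) `<=` g @^-1` U.
    by move=> G; rewrite -{1}(gK G) => /AU.
  apply: (filterS gA); apply: open_nbhs_nbhs; split.
    by apply/open_ultrafilter_spaceP; exists [set MkClop cA]; rewrite bigcup_set1.
  by rewrite -(gK F).
Qed.

Theorem theorem4p3 :
  (forall X : topologicalType, stone_space X ->
     exists (d : Order.disp_t) (B : ctbDistrLatticeType d),
       homeomorphic X (ultrafilter_space B)) /\
  (forall X : topologicalType, stone_space X ->
     homeomorphic X (ultrafilter_space (Clop X))).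
Proof.
split=> X /stone_homeomorphic_ultrafilter_space // hX.
by exists set_display, (Clop X).
Qed.
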